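(* The language $Q_I$ is reflective: for all $x, y \in V^*$, if $xy \in Q_I$ then $yx \in Q_I$.
   Context: $V$ is a finite alphabet with at least two distinct letters; $V^*$ is the set of all finite words over $V$ (including the empty word). A nonempty word $w$ is primitive if it is not of the form $v^n$ for a word $v$ and an integer $n \ge 2$. For a word $w$ of length $n$, $w[1..i]$ denotes its prefix of length $i$ and $w[i+1..n]$ its suffix of length $n-i$. A primitive word $w$ of length $n$ is ins-robust if for every $i \in \{0,\ldots,n\}$ and every $a \in V$ the word $w[1..i]\,a\,w[i+1..n]$ is primitive; $Q_I$ is the set of ins-robust primitive words. A language $L \subseteq V^*$ is reflective if $uv \in L$ implies $vu \in L$ for all $u, v \in V^*$. *)

(* Defs.v *)
From mathcomp Require Import all_boot.

Set Implicit Arguments.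
Unset Strict Implicit.
Unset Printing Implicit Defensive.

Definition language (V : Type) := seq V -> Prop.

Definition word_pow (V : Type) (v : seq V) (n : nat) : seq V :=
  flatten (nseq n v).

Definition primitive (V : Type) : language V := fun w =>
  w <> [::] /\ ~ (exists (v : seq V) (n : nat), 2 <= n /\ w = word_pow v n).

(* [insert_at w i a] is w[1..i] a w[i+1..n], for i <= n = size w. *)
Definition insert_at (V : Type) (w : seq V) (i : nat) (a : V) : seq V :=
  take i w ++ a :: drop i w.

(* The language Q_I. *)
Definition ins_robust (V : Type) : language V := fun w =>
  primitive w /\
  forall (i : nat) (a : V), i <= size w -> primitive (insert_at w i a).

Definition reflective (V : Type) (L : language V) : Prop :=
  forall u v : seq V, L (u ++ v) -> L (v ++ u).

(* Main.v *)
Require Import Defs.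
From mathcomp Require Import all_boot.

Set Implicit Arguments.
Unset Strict Implicit.
Unset Printing Implicit Defensive.

(** Every conjugate of an [n]-th power is an [n]-th power, so primitivity is
    invariant under conjugation.  A letter insertion into [yx] falls inside [y]
    or inside [x], and in both cases the resulting word is a conjugate of a
    letter insertion into [xy]. *)

Lemma word_pow_nil (V : Type) (n : nat) : word_pow [::] n = [::] :> seq V.
Proof. by elim: n. Qed.

(** One-letter rotation: the unit of the induction in [word_pow_conj]. *)
Lemma word_pow_cons_rcons (V : Type) (a : V) (p : seq V) (n : nat) :
  rcons (word_pow (a :: p) n) a = a :: word_pow (rcons p a) n.
Proof.
elim: n => //= n IHn.
by rewrite /word_pow /= rcons_cat -/(word_pow _ n) IHn cat_rcons.
Qed.

Lemma word_pow_conj (V : Type) (u v p : seq V) (n : nat) :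
  u ++ v = word_pow p n -> exists q, v ++ u = word_pow q n.
Proof.
elim: u v p => [|a u IHu] v p; first by rewrite cats0; exists p.
case: p => [|b p]; first by rewrite word_pow_nil.
move=> E; have := word_pow_cons_rcons b p n.
(* Rotating by the first letter turns the root [b :: p] into [rcons p b], so [IHu] must hold for
   every root. *)
rewrite -E /= => -[<-]; rewrite rcons_cat => /IHu [q].
by rewrite cat_rcons; exists q.
Qed.

Lemma primitive_reflective (V : Type) : reflective (@primitive V).
Proof.
move=> u v [uv_neq0 uv_npow]; split.
  by case: u v uv_neq0 {uv_npow} => [|a u] [|b v].
case=> p [n [n_gt1 /word_pow_conj [q E]]].
by apply: uv_npow; exists q, n.
Qed.

(** Trades positions for factorizations, which concatenation identities can handle. *)
Lemma ins_robustP (V : Type) (w : seq V) :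
  ins_robust w <->
  primitive w /\ forall s a t, w = s ++ t -> primitive (s ++ a :: t).
Proof.
split=> -[w_prim w_ins]; split=> //.
  move=> s a t E; have := w_ins (size s) a.
  rewrite /insert_at E take_size_cat // drop_size_cat //.
  by apply; rewrite size_cat leq_addr.
by move=> i a _; apply: w_ins; rewrite cat_take_drop.
Qed.

(** Levi's lemma: [r] is the factor between the two cuts. *)
Lemma cat_eq_cat (V : Type) (s t u v : seq V) : s ++ t = u ++ v ->
  (exists2 r, u = s ++ r & t = r ++ v) \/ (exists2 r, s = u ++ r & v = r ++ t).
Proof.
elim: s u => [|a s IHs] [|b u] /=.
- by move=> ->; left; exists [::].
- by move=> ->; left; exists (b :: u).
- by move=> <-; right; exists (a :: s).
case=> -> /IHs[] [r -> ->]; [left | right]; by exists r.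
Qed.

Theorem theorem11 (V : finType) (hV : 2 <= #|V|) : reflective (@ins_robust V).
Proof.
move=> x y /ins_robustP [xy_prim xy_ins]; apply/ins_robustP.
split=> [|s a t /esym /cat_eq_cat[] [r]]; first exact: primitive_reflective.
(* Cut inside [y = s r]: [s a r x] is conjugate to [x s a r]. *)
- move=> Ey ->; rewrite -cat_cons catA; apply: primitive_reflective.
  by rewrite catA; apply: xy_ins; rewrite Ey catA.
(* Cut inside [x = r t]: [y r a t] is conjugate to [r a t y]. *)
move=> -> Ex; rewrite -catA; apply: primitive_reflective.
by rewrite -catA; apply: xy_ins; rewrite Ex catA.
Qed.
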